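(* Let $A\in\{\rho,J\}$ and $k\in\mathbb{R}$. Let $\psi_k>0$ and $r_k>0$ denote the eigenfunctions corresponding to the principal eigenvalue $\Lambda^A(k)$ of the symmetrized tilted generator $\widetilde{\mathcal{L}}_k^A$ and to the principal eigenvalue $\lambda_{\max}^A(k)$ of the full tilted generator $\mathcal{L}_k^A$, respectively, i.e. $\widetilde{\mathcal{L}}_k^A\psi_k=\Lambda^A(k)\psi_k$ and $\mathcal{L}_k^Ar_k=\lambda_{\max}^A(k)r_k$. Then $$\lambda_{\max}^A(k)\le\Lambda^A(k),$$ with equality if and only if $\widehat{\mathcal{L}}_k^A\psi_k=0$, where $\widehat{\mathcal{L}}_k^A$ is the antisymmetric part of $\mathcal{L}_k^A$ in $L^2(\mu)$. Equivalently, equality holds if and only if $\psi_k$ is the eigenfunction of $\mathcal{L}_k^A$ corresponding to $\lambda_{\max}^A(k)$.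
   Context: Setting. $(X_t)_{t\ge0}$ is the strong solution on $\mathbb{R}^d$ of $dX_t=b(X_t)\,dt+\sigma\,dB_t$ with $b$ Lipschitz, $\sigma\in\mathbb{R}^{d\times m}$ constant with $\sigma\sigma^\top>0$, and $B$ a standard $m$-dimensional Wiener process; $D=\frac12\sigma\sigma^\top$. The process is ergodic: $\mu$ is the unique invariant probability measure (any $f\in L^2(\mu)$ with $P_tf=f$ for all $t$ is $\mu$-a.e. constant), with smooth, strictly positive density $p_{\mathrm s}$. The transition semigroup $(P_t)$ is strongly continuous on real $L^2(\mu)$ with generator $\mathcal{L}=b\cdot\nabla+\nabla\cdot D\nabla$; $\mathcal{L}$ and its $L^2(\mu)$-adjoint $\mathcal{L}^\dagger$ have a common core containing the constants. $j_{\mathrm s}=b\,p_{\mathrm s}-D\nabla p_{\mathrm s}$, $v_{\mathrm s}=j_{\mathrm s}/p_{\mathrm s}$. $\mathcal{L}_Sf=p_{\mathrm s}^{-1}\nabla\cdot(p_{\mathrm s}D\nabla f)$ and $\mathcal{L}_Af=v_{\mathrm s}\cdot\nabla f$ are the symmetric and antisymmetric parts of $\mathcal{L}$ in $L^2(\mu)$; $\mathcal{E}(f,f)=-\langle\mathcal{L}_Sf,f\rangle_\mu=\int\nabla f\cdot D\nabla f\,d\mu$ is closable. Tilted generators. Let $V\in L^\infty(\mathbb{R}^d)$ and $U\in C_b^1(\mathbb{R}^d;\mathbb{R}^d)$ (bounded, continuously differentiable, bounded derivatives). $\mathcal{L}_k^A$ is the $L^2(\mu)$-generator of the strongly continuous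 Feynman-Kac semigroup $(P_t^{k,A}f)(x)=\mathbb{E}^x[f(X_t)e^{kA_t}]$, with $A_t=\int_0^tV(X_s)\,ds$ for $A=\rho$ and $A_t=\int_0^tU(X_s)\circ dX_s$ (Stratonovich) for $A=J$. Explicitly $\mathcal{L}_k^\rho=\mathcal{L}+kV$ and $\mathcal{L}_k^Jf=\mathcal{L}f+k(b\cdot U+\nabla\cdot DU)f+2kU\cdot D\nabla f+k^2(U\cdot DU)f$. With $\dagger$ the $L^2(\mu)$-adjoint, $\widetilde{\mathcal{L}}_k^A=\frac12[\mathcal{L}_k^A+(\mathcal{L}_k^A)^\dagger]$ (self-adjoint) and $\widehat{\mathcal{L}}_k^A=\frac12[\mathcal{L}_k^A-(\mathcal{L}_k^A)^\dagger]$; explicitly $\widetilde{\mathcal{L}}_k^\rho=\mathcal{L}_S+kV$, $\widehat{\mathcal{L}}_k^\rho=\mathcal{L}_A$, $\widetilde{\mathcal{L}}_k^J=\mathcal{L}_S+k(v_{\mathrm s}\cdot U)+k^2(U\cdot DU)$, $\widehat{\mathcal{L}}_k^Jf=\mathcal{L}_Af+2k(DU)\cdot\nabla f+kp_{\mathrm s}^{-1}\nabla\cdot(p_{\mathrm s}DU)f$. $\Lambda^A(k)=\sup\{\langle\mathcal{L}_k^Af,f\rangle_\mu: f\in D(\mathcal{L}_k^A),\|f\|_{L^2(\mu)}=1\}$, which is the largest eigenvalue of $\widetilde{\mathcal{L}}_k^A$, a simple eigenvalue. $\lambda_{\max}^A(k)$ is the (real) eigenvalue of $\mathcal{L}_k^A$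 with largest real part. The existence of the positive eigenfunctions $\psi_k,r_k\in L^2(\mu)$, lying in the domains of all operators involved, is part of the hypotheses. *)

(* Defs.v *)
From HB Require Import structures.
From mathcomp Require Import all_boot all_order all_algebra.
From mathcomp Require Import complex.
From mathcomp Require Import all_classical all_reals all_analysis.
Set Implicit Arguments.
Unset Strict Implicit.
Unset Printing Implicit Defensive.
Import Order.TTheory GRing.Theory Num.Theory.
Import numFieldNormedType.Exports.
Local Open Scope classical_set_scope.
Local Open Scope ring_scope.

Definition borel_mx_display : measure_display. Proof. exact. Qed.

Section borel_matrix.
Context (R : realType) (p q : nat).
Local Notation borel := <<s @open 'M[R]_(p, q) >>.

Let borel0 : borel set0. Proof. exact: sigma_algebra0. Qed.
Let borelC A : borel A -> borel (~` A). Proof. exact: sigma_algebraC. Qed.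
Let borelU (F : (set 'M[R]_(p, q))^nat) :
  (forall i, borel (F i)) -> borel (\bigcup_i F i).
Proof. exact: sigma_algebra_bigcup. Qed.

HB.instance Definition _ :=
  @isMeasurable.Build borel_mx_display 'M[R]_(p, q) borel borel0 borelC borelU.
End borel_matrix.

Section euclidean.
Context (R : realType) (d : nat).
Local Notation E := 'cV[R]_d.
Implicit Types (f : E -> R) (U : E -> E).

Definition dotv (u v : E) : R := \sum_i u i 0 * v i 0.

Definition evec (i : 'I_d) : E := delta_mx i 0.

Definition iter_partial (s : seq 'I_d) f : E -> R :=
  foldr (fun i g x => 'D_(evec i) g x) f s.

Definition smooth f := forall s x, differentiable (iter_partial s f) x.

Definition Cb1 U :=
  [/\ exists M, forall x, `|U x| <= M,
      forall x, differentiable U x,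
      forall i, continuous (fun x => 'D_(evec i) U x) &
      exists M, forall i x, `|'D_(evec i) U x| <= M].

(* The values on boxes determine Lebesgue measure on the Borel sets of R^d. *)
Definition is_lebesgue (leb : {measure set E -> \bar R}) :=
  forall a b : E, (forall i, a i 0 <= b i 0) ->
  leb [set x | forall i, a i 0 <= x i 0 <= b i 0]
  = (\prod_i (b i 0 - a i 0))%:E.
End euclidean.

(* Processes are indexed by R; only times t >= 0 are meaningful. *)
Section diffusion.
Context (R : realType) (d m : nat) (dO : measure_display).
Context (Omega : measurableType dO) (P : probability Omega R).
Local Notation E := 'cV[R]_d.

(* The product formula says at once that the coordinates of the increments are
   mutually independent and that each of them is centred Gaussian with variance
   the length of the time interval. *)
Definition brownian_motion (B : R -> Omega -> 'cV[R]_m) :=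
  [/\ forall t : R, 0 <= t -> measurable_fun setT (B t),
      {ae P, forall w, B 0 w = 0 /\ {within `[0, +oo[, continuous (B ^~ w)}} &
      forall (n : nat) (t : nat -> R) (A : 'I_n -> 'I_m -> set R),
        0 <= t 0%N -> (forall i, t i < t i.+1) ->
        (forall i j, measurable (A i j)) ->
        P [set w | forall i j, A i j (B (t i.+1) w j 0 - B (t i) w j 0)]
        = (\prod_(i < n) \prod_(j < m)
            normal_prob 0 (Num.sqrt (t i.+1 - t i)) (A i j))%E].

Definition history (B : R -> Omega -> 'cV[R]_m) (t : R) : set (set Omega) :=
  <<s [set C | exists (s : R) A,
        [/\ 0 <= s <= t, measurable A & C = B s @^-1` A]] >>.

(* X is the strong solution of dX = b(X) dt + sigma dB started at x. The noise
   is additive, so that the stochastic integral is sigma * B_t. Adaptedness is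
   with respect to the history of B augmented by the null sets. *)
Definition strong_solution (b : E -> E) (sigma : 'M[R]_(d, m))
    (B : R -> Omega -> 'cV[R]_m) (x : E) (X : R -> Omega -> E) :=
  [/\ forall t : R, 0 <= t -> measurable_fun setT (X t),
      forall (t : R) (A : set E), 0 <= t -> measurable A ->
        exists2 C, history B t C & P ((X t @^-1` A) `+` C) = 0%E &
      {ae P, forall w, {within `[0, +oo[, continuous (X ^~ w)} /\
        forall (t : R) i, 0 <= t ->
        X t w i 0 = x i 0
          + \int[lebesgue_measure]_(s in `[0, t]) (b (X s w) i 0)
          + (sigma *m B t w) i 0}].

(* [occupation V] is the empirical density functional of V, [current U] the
   empirical current functional of U. *)
Inductive observable :=
  | occupation of E -> R
  | current of E -> E.

Definition admissible (leb : {measure set E -> \bar R}) (a : observable) : Prop :=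
  match a with
  | occupation V => V \in Lfun leb +oo%E
  | current U => Cb1 U
  end.

(* The Stratonovich sum of U(X) o dX over the partition 0 :: s. *)
Definition strato_sum (U : E -> E) (X : R -> Omega -> E) (s : seq R)
    (w : Omega) : R :=
  \sum_(i < size s)
    dotv (2^-1 *: (U (X (nth 0 (0 :: s) i) w) + U (X (nth 0 (0 :: s) i.+1) w)))
         (X (nth 0 (0 :: s) i.+1) w - X (nth 0 (0 :: s) i) w).

(* Y is the Stratonovich integral of U(X) o dX over [0, t]: the limit in
   probability of the sums when the mesh of the partition tends to 0. *)
Definition strato_integral (U : E -> E) (X : R -> Omega -> E) (t : R)
    (Y : Omega -> R) :=
  forall e : R, 0 < e -> exists2 delta : R, 0 < delta &
  forall s : seq R, path <%R 0 s -> last 0 s = t ->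
    (forall i, (i < size s)%N ->
       nth 0 (0 :: s) i.+1 - nth 0 (0 :: s) i < delta) ->
    (P [set w | (e < `|strato_sum U X s w - Y w|)%R] <= e%:E)%E.

Definition is_functional (a : observable) (X : R -> Omega -> E)
    (A : R -> Omega -> R) :=
  forall t : R, 0 <= t -> measurable_fun setT (A t) /\
  match a with
  | occupation V =>
      {ae P, forall w, A t w = \int[lebesgue_measure]_(s in `[0, t]) V (X s w)}
  | current U => strato_integral U X t (A t)
  end.

(* In what follows X x is the process started at x, and similarly for A x. *)
Definition transition (X : E -> R -> Omega -> E) (t : R) (f : E -> R) : E -> R :=
  fun x => \int[P]_w f (X x t w).

Definition feynman_kac (X : E -> R -> Omega -> E) (A : E -> R -> Omega -> R)
    (k t : R) (f : E -> R) : E -> R :=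
  fun x => \int[P]_w (f (X x t w) * expR (k * A x t w)).

Definition invariant_measure (X : E -> R -> Omega -> E) (nu : probability E R) :=
  forall (t : R) (A : set E), 0 <= t -> measurable A ->
  (\int[nu]_x P [set w | A (X x t w)] = nu A)%E.
End diffusion.

Section L2_operators.
Context (R : realType) (dT : measure_display) (T : measurableType dT).
Context (mu : {measure set T -> \bar R}).
Local Notation L2 := (Lfun mu 2%:E).
Local Notation N2 f := ('N[mu]_2%:E[EFin \o f%R]%E).
Implicit Types (f g h : T -> R).

Definition ip f g : R := \int[mu]_x (f x * g x).

Definition C0_semigroup (Q : R -> (T -> R) -> T -> R) :=
  [/\ forall (t : R) f, 0 <= t -> f \in L2 -> Q t f \in L2,
      forall (t c : R) f g, 0 <= t -> f \in L2 -> g \in L2 ->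
        Q t (fun x => c * f x + g x)
        = (fun x => c * Q t f x + Q t g x) %[ae mu],
      forall t : R, 0 <= t -> exists M : R, forall f, f \in L2 ->
        (N2 (Q t f) <= M%:E * N2 f)%E,
      (forall f, f \in L2 -> Q 0 f = f %[ae mu]) /\
      (forall (s t : R) f, 0 <= s -> 0 <= t -> f \in L2 ->
        Q (s + t) f = Q s (Q t f) %[ae mu]) &
      forall f, f \in L2 ->
        N2 (fun x => Q t f x - f x) @[t --> 0^'+] --> 0%E].

(* An unbounded operator on L2(mu) is represented by its graph: [S f g] means
   that f is in the domain of S and that S f = g almost everywhere. *)
Definition operator := (T -> R) -> (T -> R) -> Prop.
Implicit Types S : operator.

Definition dom S f := exists g, S f g.

Definition generator (Q : R -> (T -> R) -> T -> R) : operator := fun f g =>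
  [/\ f \in L2, g \in L2 &
      N2 (fun x => t^-1 * (Q t f x - f x) - g x) @[t --> 0^'+] --> 0%E].

Definition adjoint S : operator := fun g h =>
  [/\ g \in L2, h \in L2 & forall f f', S f f' -> ip f' g = ip f h].

(* Both parts of S live on the intersection of the domains of S and of its
   adjoint. The sum [sym_part S] need not be closed there; the self-adjoint
   operator it stands for is its closure, so that self-adjointness is required
   below in the form [essentially_self_adjoint (sym_part S)]. *)
Definition sym_part S : operator := fun f g => g \in L2 /\
  exists g1 g2, [/\ S f g1, adjoint S f g2 &
    g = (fun x => 2^-1 * (g1 x + g2 x)) %[ae mu]].

Definition antisym_part S : operator := fun f g => g \in L2 /\
  exists g1 g2, [/\ S f g1, adjoint S f g2 &
    g = (fun x => 2^-1 * (g1 x - g2 x)) %[ae mu]].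

Definition op_closure S : operator := fun f g =>
  [/\ f \in L2, g \in L2 & forall e : R, 0 < e -> exists f' g',
    [/\ S f' g', (N2 (fun x => f x - f' x) < e%:E)%E &
        (N2 (fun x => g x - g' x) < e%:E)%E]].

Definition core S (C : set (T -> R)) :=
  [/\ forall f, C f -> dom S f,
      C (cst 0) /\ (forall (c : R) f g, C f -> C g ->
        C (fun x => c * f x + g x)) &
      forall f g, S f g -> op_closure (fun f' g' => C f' /\ S f' g') f g].

Definition densely_defined S := forall f, f \in L2 -> forall e : R, 0 < e ->
  exists2 f', dom S f' & (N2 (fun x => f x - f' x) < e%:E)%E.

Definition self_adjoint S :=
  densely_defined S /\ forall f g, S f g <-> adjoint S f g.

Definition essentially_self_adjoint S := self_adjoint (op_closure S).

Definition eigenfunction S (l : R) f :=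
  S f (fun x => l * f x) /\ ~ (f = cst 0 %[ae mu]).

(* z is an eigenvalue of the complexification of S, with eigenfunction u + iv. *)
Definition complex_eigenvalue S (z : R[i]) := exists u v : T -> R,
  [/\ S u (fun x => complex.Re z * u x - complex.Im z * v x),
      S v (fun x => complex.Re z * v x + complex.Im z * u x) &
      ~ (u = cst 0 %[ae mu] /\ v = cst 0 %[ae mu])].

Definition leading_eigenvalue S (l : R) :=
  complex_eigenvalue S (l%:C)%C /\
  forall z, complex_eigenvalue S z -> complex.Re z <= l.

Definition largest_eigenvalue S (l : R) :=
  (exists f, eigenfunction S l f) /\
  forall l' f, eigenfunction S l' f -> l' <= l.

Definition simple_eigenvalue S (l : R) :=
  (exists f, eigenfunction S l f) /\
  forall f g, eigenfunction S l f -> eigenfunction S l g ->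
    exists c : R, f = (fun x => c * g x) %[ae mu].

Definition rayleigh_sup S : \bar R :=
  ereal_sup [set y | exists f g,
    [/\ S f g, N2 f = 1%E & y = (ip g f)%:E]].
End L2_operators.

Section setting.
Context (R : realType) (d m : nat) (dO : measure_display).
Context (Omega : measurableType dO) (P : probability Omega R).
Local Notation E := 'cV[R]_d.
Implicit Types (X : E -> R -> Omega -> E) (mu : probability E R).

Record diffusion (b : E -> E) (sigma : 'M[R]_(d, m))
    (B : R -> Omega -> 'cV[R]_m) X : Prop := {
  drift_lipschitz : exists k : R, k.-lipschitz b ;
  noise_nondegenerate :
    forall u : E, u != 0 -> 0 < dotv u (sigma *m sigma^T *m u) ;
  noise_brownian : brownian_motion P B ;
  solution : forall x, strong_solution P b sigma B x (X x)
}.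

Record ergodic X (leb : {measure set E -> \bar R}) mu : Prop := {
  mu_invariant : invariant_measure P X mu ;
  mu_unique : forall nu : probability E R, invariant_measure P X nu ->
    forall A, measurable A -> nu A = mu A ;
  mu_ergodic : forall f, f \in Lfun mu 2%:E ->
    (forall t : R, 0 <= t -> transition P X t f = f %[ae mu]) ->
    exists c : R, f = cst c %[ae mu] ;
  mu_density : exists ps : E -> R, [/\ smooth ps, forall x, 0 < ps x &
    forall A, measurable A -> mu A = (\int[leb]_(x in A) (ps x)%:E)%E] ;
  transition_semigroup : C0_semigroup mu (transition P X) ;
  common_core : exists C : set (E -> R),
    [/\ core mu (generator mu (transition P X)) C,
        core mu (adjoint mu (generator mu (transition P X))) C &
        forall c, C (cst c)]
}.

Definition tilted_generator mu X (A : E -> R -> Omega -> R) (k : R) :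
    operator R E :=
  generator mu (feynman_kac P X A k).

Record tilted mu X (A : E -> R -> Omega -> R) (k : R) : Prop := {
  fk_integrable : forall (t : R) f, 0 <= t -> f \in Lfun mu 2%:E ->
    {ae mu, forall x,
      P.-integrable setT (fun w => (f (X x t w) * expR (k * A x t w))%:E)} ;
  fk_semigroup : C0_semigroup mu (feynman_kac P X A k) ;
  sym_self_adjoint :
    essentially_self_adjoint mu (sym_part mu (tilted_generator mu X A k))
}.
End setting.

(* Main.v *)
Require Import Defs.
From mathcomp Require Import all_boot all_order all_algebra.
From mathcomp Require Import ring lra complex.
From mathcomp Require Import all_classical all_reals all_analysis.
From mathcomp Require Import measurable_realfun.
Set Implicit Arguments.
Unset Strict Implicit.
Unset Printing Implicit Defensive.
Import Order.TTheory GRing.Theory Num.Theory.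
Import numFieldNormedType.Exports.
Local Open Scope classical_set_scope.
Local Open Scope ring_scope.

(** Write S for the tilted generator and <f, g> for the inner product of L2(mu).

    The inequality is the Rayleigh principle: r is a competitor in the supremum
    defining Lambda, and its Rayleigh quotient is
    <S r, r> / <r, r> = lambda_max.

    If lambda_max = Lambda, then r attains that supremum. Since r lies in the
    domains of both S and its adjoint, the first variation of the quotient at r
    can be computed: it vanishes against the whole domain of S, which is dense,
    and this is the eigenvalue equation of the symmetric part at r
    ([rayleigh_maximizer]). Simplicity of Lambda makes psi a multiple of r
    almost everywhere, so that S psi = Lambda psi. Conversely S psi = Lambda psi
    makes Lambda an eigenvalue of S, hence Lambda <= lambda_max because
    lambda_max has the largest real part ([leading_eigenvalue_eqP]).

    Both forms of the equality case reduce to the equation S psi = Lambda psi.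
    For the antisymmetric part this is because the symmetric part of S is
    Lambda psi at psi, and S is the sum of its two parts
    ([sym_part_antisym_part0]). If S psi = lambda_max psi, then S and its
    symmetric part have the same quadratic form at psi, which forces
    lambda_max = Lambda ([sym_part_eigenvalue_eq]).

    Operators are graphs on functions, not on classes modulo null sets, so
    single-valuedness holds only almost everywhere and has to be proved. It
    comes from duality: S and its adjoint are both densely defined, because the
    symmetric part is, and each determines the values of the other
    ([operator_functional], [adjoint_functional]). *)

(** * The inner product of L2 *)

Section inner_product.
Context (R : realType) (dT : measure_display) (T : measurableType dT).
Context (mu : {measure set T -> \bar R}).
Local Notation L2 := (Lfun mu 2%:E).
Local Notation N2 f := ('N[mu]_2%:E[EFin \o f%R]%E).
Local Notation ip := (ip mu).
Implicit Types (f g h : T -> R) (c : R).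

Lemma L2_measurable f : f \in L2 -> measurable_fun setT f.
Proof. by rewrite inE => /andP[/[!inE]]. Qed.

Lemma L2_lincomb c f g : f \in L2 -> g \in L2 ->
  (fun x => c * f x + g x) \in L2.
Proof.
by have [_] := @Lfun_submod_closed _ _ _ mu 2%:E (lee1n 2); exact.
Qed.

Lemma L2_cst0 : cst 0 \in L2.
Proof. by have [] := @Lfun_submod_closed _ _ _ mu 2%:E (lee1n 2). Qed.

Lemma L2_scale c f : f \in L2 -> (fun x => c * f x) \in L2.
Proof.
move=> f2; rewrite (_ : (fun x => _) = fun x => c * f x + cst 0 x).
  exact: L2_lincomb L2_cst0.
by apply/funext => x; rewrite addr0.
Qed.

Lemma L2_add f g : f \in L2 -> g \in L2 -> (fun x => f x + g x) \in L2.
Proof.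
move=> f2 g2; rewrite (_ : (fun x => _) = fun x => 1 * f x + g x).
  exact: L2_lincomb.
by apply/funext => x; rewrite mul1r.
Qed.

Lemma L2_sub f g : f \in L2 -> g \in L2 -> (fun x => f x - g x) \in L2.
Proof.
move=> f2 g2; rewrite (_ : (fun x => _) = fun x => -1 * g x + f x).
  exact: L2_lincomb.
by apply/funext => x; rewrite mulN1r addrC.
Qed.

Lemma integrable_mul f g : f \in L2 -> g \in L2 ->
  mu.-integrable setT (EFin \o (fun x => f x * g x)).
Proof. by move=> f2 g2; apply/Lfun1_integrable/Lfun2_mul_Lfun1. Qed.

Lemma ipC f g : ip f g = ip g f.
Proof. by rewrite /Defs.ip; under eq_Rintegral do rewrite mulrC. Qed.

Lemma ip_lincombl c f g h : f \in L2 -> g \in L2 -> h \in L2 ->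
  ip (fun x => c * f x + g x) h = c * ip f h + ip g h.
Proof.
move=> f2 g2 h2; rewrite /Defs.ip.
rewrite -RintegralZl ?integrable_mul// -RintegralD//.
- by under eq_Rintegral do rewrite mulrDl -mulrA.
- rewrite (_ : _ \o _ = EFin \o (fun x => c * f x * h x)).
    by apply: integrable_mul => //; exact: L2_scale.
  by apply/funext => x /=; rewrite mulrA.
- exact: integrable_mul.
Qed.

Lemma ip_lincombr c f g h : f \in L2 -> g \in L2 -> h \in L2 ->
  ip h (fun x => c * f x + g x) = c * ip h f + ip h g.
Proof. by move=> *; rewrite ipC ip_lincombl// !(ipC h). Qed.

Lemma ip0l g : ip (cst 0) g = 0.
Proof.
rewrite /Defs.ip; under eq_Rintegral do rewrite mul0r.
by rewrite /Rintegral integral0.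
Qed.

Lemma ip_scalel c f g : f \in L2 -> g \in L2 ->
  ip (fun x => c * f x) g = c * ip f g.
Proof.
move=> f2 g2; rewrite -[RHS]addr0 -(ip0l g) -ip_lincombl ?L2_cst0//.
by congr ip; apply/funext => x; rewrite addr0.
Qed.

Lemma ip_scaler c f g : f \in L2 -> g \in L2 ->
  ip f (fun x => c * g x) = c * ip f g.
Proof. by move=> *; rewrite ipC ip_scalel// ipC. Qed.

Lemma ip_subl f g h : f \in L2 -> g \in L2 -> h \in L2 ->
  ip (fun x => f x - g x) h = ip f h - ip g h.
Proof.
move=> f2 g2 h2; rewrite addrC -mulN1r -ip_lincombl//.
by congr ip; apply/funext => x; rewrite mulN1r addrC.
Qed.

Lemma ip_addl f g h : f \in L2 -> g \in L2 -> h \in L2 ->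
  ip (fun x => f x + g x) h = ip f h + ip g h.
Proof.
move=> f2 g2 h2; rewrite -(mul1r (ip f h)) -ip_lincombl//.
by congr ip; apply/funext => x; rewrite mul1r.
Qed.

Lemma ip_ae_eql f g h : f \in L2 -> g \in L2 -> h \in L2 ->
  f = g %[ae mu] -> ip f h = ip g h.
Proof.
move=> f2 g2 h2 fg; rewrite /Defs.ip /Rintegral; congr fine.
apply: ae_eq_integral => //.
- exact/measurable_EFinP/measurable_funM/L2_measurable/h2/L2_measurable.
- exact/measurable_EFinP/measurable_funM/L2_measurable/h2/L2_measurable.
- by move: fg; apply: filterS => x /= fg _; rewrite fg.
Qed.

Lemma ip_ge0 f : 0 <= ip f f.
Proof. by apply: Rintegral_ge0 => x _; rewrite -expr2 sqr_ge0. Qed.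

Lemma Lnorm2E f : f \in L2 -> N2 f = (Num.sqrt (ip f f))%:E.
Proof.
move=> f2; rewrite unlock.
under eq_integral => x _.
  rewrite /= powR_mulrn ?normr_ge0// real_normK ?num_real// expr2.
  over.
rewrite -powR12_sqrt ?ip_ge0// -poweR_EFin; congr (_ `^ _)%E.
rewrite /Defs.ip /Rintegral fineK//.
exact: integrable_fin_num (integrable_mul _ _).
Qed.

Lemma ip_eq0 f : f \in L2 -> ip f f = 0 -> f = cst 0 %[ae mu].
Proof.
move=> f2 f0; have : N2 f = 0%E by rewrite Lnorm2E// f0 sqrtr0.
have mf : measurable_fun setT (EFin \o f).
  exact/measurable_EFinP/L2_measurable.
have two_gt0 : (0 < 2%:E :> \bar R)%E by rewrite lte_fin.
move=> /(Lnorm_eq0_eq0 mf two_gt0).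
by apply: filterS => x /(_ I) [] + _.
Qed.

Lemma ip_gt0 f : f \in L2 -> ~ f = cst 0 %[ae mu] -> 0 < ip f f.
Proof.
move=> f2 f0; rewrite lt_neqAle ip_ge0 andbT eq_sym.
by apply/eqP => /(ip_eq0 f2).
Qed.

Lemma Lnorm2_scale c f : f \in L2 ->
  N2 (fun x => c * f x) = (`|c|%:E * N2 f)%E.
Proof.
move=> f2; rewrite !Lnorm2E ?L2_scale// ip_scalel ?L2_scale// ip_scaler//.
by rewrite mulrA -expr2 sqrtrM ?sqr_ge0// sqrtr_sqr.
Qed.

Lemma Lnorm2_ae_eq f g : f \in L2 -> g \in L2 ->
  f = g %[ae mu] -> N2 f = N2 g.
Proof.
move=> f2 g2 fg; rewrite !Lnorm2E//.
by rewrite (ip_ae_eql f2 g2 f2 fg) ipC (ip_ae_eql f2 g2 g2 fg).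
Qed.

End inner_product.

(** The first-order condition for a minimum at 0 of a quadratic polynomial. *)
Lemma quadratic_ge0_linear_eq0 (R : realFieldType) (b c : R) :
  (forall t, 0 <= 2 * t * b + t ^+ 2 * c) -> b = 0.
Proof.
(* With t = - b / k the value is (b / k)^2 (c - 2 k), and k is chosen to make
   the second factor negative. *)
move=> q_ge0; pose k := 1 + `|c|.
have k_gt0 : 0 < k by rewrite ltr_pwDl.
have ck : c - 2 * k < 0.
  by rewrite subr_lt0 /k; have := ler_norm c; have := normr_ge0 c; lra.
have := q_ge0 (- b / k).
have -> : 2 * (- b / k) * b + (- b / k) ^+ 2 * c = (b / k) ^+ 2 * (c - 2 * k).
  by field; rewrite gt_eqF.
rewrite nmulr_lge0// => /(conj (sqr_ge0 (b / k))) /andP.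
rewrite andbC -eq_le sqrf_eq0 mulf_eq0 invr_eq0 (gt_eqF k_gt0) orbF.
by move/eqP.
Qed.

(** * Linear operators and their symmetric parts *)

Section operators.
Context (R : realType) (dT : measure_display) (T : measurableType dT).
Context (mu : {measure set T -> \bar R}).
Local Notation L2 := (Lfun mu 2%:E).
Local Notation N2 f := ('N[mu]_2%:E[EFin \o f%R]%E).
Local Notation ip := (ip mu).
Local Notation operator := (operator R T).
Implicit Types (f g h : T -> R) (c : R) (S : operator).

(** Invariance under a change on a null set is required of the values alone; for
    the arguments it follows by duality once the adjoint is densely defined, see
    [operator_functional]. *)
Record linear_operator S : Prop := {
  operator_dom_L2 : forall f g, S f g -> f \in L2 ;
  operator_val_L2 : forall f g, S f g -> g \in L2 ;
  operator_lincomb : forall c f f' g g', S f f' -> S g g' ->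
    S (fun x => c * f x + g x) (fun x => c * f' x + g' x) ;
  operator_ae_val : forall f g g', S f g -> g' \in L2 ->
    g = g' %[ae mu] -> S f g'
}.

Lemma operator0 S f g : linear_operator S -> S f g -> S (cst 0) (cst 0).
Proof.
move=> linS fg; have N1 u : cst 0 = (fun x => -1 * u x + u x) :> (T -> R).
  by apply/funext => x; rewrite mulN1r addNr.
by rewrite {1}(N1 f) (N1 g); exact: operator_lincomb.
Qed.

Lemma operator_scale S c f g : linear_operator S -> S f g ->
  S (fun x => c * f x) (fun x => c * g x).
Proof.
move=> linS fg.
have D0 (u : T -> R) : (fun x => c * u x) = (fun x => c * u x + cst 0 x).
  by apply/funext => x; rewrite addr0.
by rewrite (D0 f) (D0 g); apply: operator_lincomb => //; exact: operator0 fg.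
Qed.

Lemma densely_defined_sub S S' : (forall f, dom S f -> dom S' f) ->
  densely_defined mu S -> densely_defined mu S'.
Proof.
move=> sub dS f f2 e e0; have [f' Sf' ?] := dS f f2 e e0.
by exists f' => //; exact: sub.
Qed.

(** The domain of an operator is dense in that of its closure for the graph
    norm, a fortiori for the norm of L2. *)
Lemma densely_defined_closure S : (forall f, dom S f -> f \in L2) ->
  densely_defined mu (op_closure mu S) -> densely_defined mu S.
Proof.
move=> SL2 dS f f2 e e0.
have [f' [g [f'2 _ /(_ (e / 2))]]] := dS f f2 (e / 2) (divr_gt0 e0 (ltr0n _ 2)).
move=> /(_ (divr_gt0 e0 (ltr0n _ 2))) [f'' [g'' [Sf'' f'f'' _]]] ff'.
exists f''; first by exists g''.
have f''2 : f'' \in L2 by apply: SL2; exists g''.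
have -> : (fun x => f x - f'' x) =
    ((fun x => f x - f' x) \+ (fun x => f' x - f'' x)).
  by apply/funext => x /=; rewrite subrKA.
apply: le_lt_trans (eminkowski _ _ _ _) _.
- exact: L2_measurable (L2_sub f2 f'2).
- exact: L2_measurable (L2_sub f'2 f''2).
- by rewrite lee_fin ler1n.
- by rewrite [e in (_ < e%:E)%E]splitr [ltRHS]EFinD; exact: lteD.
Qed.

(** If u = f - g is orthogonal to h, then |u - h|^2 = |u|^2 + |h|^2 >= |u|^2;
    letting h approach u within a dense domain gives u = 0. *)
Lemma dense_separates S f g : densely_defined mu S ->
  (forall h, dom S h -> h \in L2) -> f \in L2 -> g \in L2 ->
  (forall h, dom S h -> ip f h = ip g h) -> f = g %[ae mu].
Proof.
move=> dS SL2 f2 g2 fg.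
have [u uE] : exists u, u = fun x => f x - g x by eexists.
have u2 : u \in L2 by rewrite uE L2_sub.
have uu0 : ip u u = 0.
  apply/eqP; rewrite eq_le ip_ge0 andbT; apply/ler_addgt0Pr => e e0.
  rewrite add0r.
  have [|h Sh] := dS u u2 (Num.sqrt e); first by rewrite sqrtr_gt0.
  have h2 := SL2 _ Sh.
  rewrite Lnorm2E ?L2_sub// lte_fin ltr_sqrt// => uh.
  apply: le_trans (ltW uh).
  have uh0 : ip u h = 0 by rewrite uE ip_subl// fg// subrr.
  rewrite ip_subl// ?L2_sub// ![ip _ (fun x => u x - h x)]ipC !ip_subl//.
  by rewrite (ipC _ h u) uh0 subr0 sub0r opprK lerDl ip_ge0.
have := ip_eq0 u2 uu0; apply: filterS => x + _ => /(_ I) /eqP.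
by rewrite uE subr_eq0 => /eqP.
Qed.

Lemma sym_part_dom S f g : sym_part mu S f g ->
  dom S f /\ dom (adjoint mu S) f.
Proof. by move=> [_ [g1 [g2 [? ? _]]]]; split; [exists g1|exists g2]. Qed.

Lemma dom_adjoint_L2 S f : dom (adjoint mu S) f -> f \in L2.
Proof. by move=> [g []]. Qed.

(** For real functions <S^* f, f> = <S f, f>, so that passing to the symmetric
    part does not change the quadratic form. *)
Lemma sym_part_form S f f' g : linear_operator S -> sym_part mu S f g ->
  S f f' -> ip g f = ip f' f.
Proof.
move=> linS [g2 [g1 [g1' [Sf adjf gE]]]] Sff'.
have [f2 g12] := (operator_dom_L2 linS Sf, operator_val_L2 linS Sf).
have [_ g1'2 adj] := adjf.
have half2 : (fun x => 2^-1 * (g1 x + g1' x)) \in L2.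
  by apply: L2_scale; exact: L2_add.
rewrite (ip_ae_eql g2 half2 f2 gE) ip_scalel ?L2_add// ip_addl//.
by rewrite (ipC _ g1') -(adj _ _ Sf) (adj _ _ Sff') (adj _ _ Sf); field.
Qed.

Section with_operator.
Context (S : operator) (linS : linear_operator S).
Context (dsym : densely_defined mu (sym_part mu S)).

Let dS : densely_defined mu S.
Proof. by apply: densely_defined_sub dsym => f [g /sym_part_dom[]]. Qed.

Let dSadj : densely_defined mu (adjoint mu S).
Proof. by apply: densely_defined_sub dsym => f [g /sym_part_dom[]]. Qed.

Let S_L2 f : dom S f -> f \in L2.
Proof. by move=> [g /(operator_dom_L2 linS)]. Qed.

(** A linear operator with a densely defined adjoint is single-valued on classes
    modulo null sets: <S f, h> = <f, S^* h> depends only on the class of f. *)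
Lemma operator_functional f g f' g' : S f f' -> S g g' ->
  f = g %[ae mu] -> f' = g' %[ae mu].
Proof.
move=> Sf Sg fg.
have [f2 f'2] := (operator_dom_L2 linS Sf, operator_val_L2 linS Sf).
have [g2 g'2] := (operator_dom_L2 linS Sg, operator_val_L2 linS Sg).
apply: (dense_separates dSadj) => //; first exact: dom_adjoint_L2.
move=> h [h' [h2 h'2 adj]].
by rewrite (adj _ _ Sf) (adj _ _ Sg) (ip_ae_eql _ _ _ fg).
Qed.

Lemma adjoint_functional f g g' : adjoint mu S f g -> adjoint mu S f g' ->
  g = g' %[ae mu].
Proof.
move=> [f2 g2 adj] [_ g'2 adj']; apply: (dense_separates dS) => // h [h' Sh].
by rewrite ipC -(adj _ _ Sh) (adj' _ _ Sh) ipC.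
Qed.

(** S is the sum of its two parts; the point is that the witnesses of the two
    parts are the same values of S and of its adjoint almost everywhere. *)
Lemma sym_part_antisym_part0 f g : sym_part mu S f g ->
  antisym_part mu S f (cst 0) <-> S f g.
Proof.
move=> [g2 [g1 [g1' [Sf adjf gE]]]]; split.
  move=> [_ [h1 [h1' [Sf' adjf' E0]]]].
  apply: (operator_ae_val linS Sf g2).
  have g1h1 := operator_functional Sf Sf' (ae_eq_refl _ _ _).
  have g1h1' := adjoint_functional adjf adjf'.
  near=> x => _.
  have /(_ I) gx : setT x -> g x = 2^-1 * (g1 x + g1' x) by near: x.
  have /(_ I) zx : setT x -> cst 0 x = 2^-1 * (h1 x - h1' x) by near: x.
  have /(_ I) e1 : setT x -> g1 x = h1 x by near: x.
  have /(_ I) e2 : setT x -> g1' x = h1' x by near: x.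
  by rewrite gx; move: zx => /=; rewrite -e1 -e2; lra.
move=> Sfg; split; first exact: L2_cst0.
exists g1, g1'; split => //.
have gg1 := operator_functional Sfg Sf (ae_eq_refl _ _ _).
move: gE gg1; apply: filterS2 => x /(_ I) -> /(_ I) e _ /=; lra.
Unshelve. all: end_near. Qed.

(** The supremum only sees unit vectors; homogeneity extends the bound. *)
Lemma rayleigh_sup_bound (L : R) f g : rayleigh_sup mu S = L%:E -> S f g ->
  ip g f <= L * ip f f.
Proof.
move=> supL Sfg.
have [f2 g2] := (operator_dom_L2 linS Sfg, operator_val_L2 linS Sfg).
have [/(ip_eq0 f2) f0|f0] := eqVneq (ip f f) 0.
  by rewrite !(ipC _ _ f) !(ip_ae_eql _ _ _ f0) ?L2_cst0// !ip0l mulr0.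
have ff_gt0 : 0 < ip f f by rewrite lt_neqAle eq_sym f0 ip_ge0.
pose c := (Num.sqrt (ip f f))^-1.
have c2 : c ^+ 2 = (ip f f)^-1 by rewrite exprVn sqr_sqrtr ?ltW.
have : ((c ^+ 2 * ip g f)%:E <= L%:E)%E.
  rewrite -supL; apply: ereal_sup_ubound => /=.
  exists (fun x => c * f x), (fun x => c * g x); split.
  - exact: operator_scale.
  - rewrite Lnorm2E ?L2_scale// ip_scalel ?L2_scale// ip_scaler//.
    by rewrite mulrA -expr2 c2 mulVf// sqrtr1.
  - by rewrite ip_scalel ?L2_scale// ip_scaler// mulrA.
by rewrite lee_fin c2 mulrC ler_pdivrMr.
Qed.

(** The form L |.|^2 - <S ., .> is nonnegative on the domain of S and vanishes
    at f. Its restriction to the line f + t h is a quadratic polynomial in t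
    without constant term, so its linear coefficient vanishes. The adjoint turns
    the term <S h, f> into <h, S^* f>, after which this coefficient is
    2 <L f - (S f + S^* f) / 2, h>. *)
Lemma rayleigh_maximizer (L : R) f g : rayleigh_sup mu S = L%:E ->
  S f g -> dom (adjoint mu S) f -> ip g f = L * ip f f ->
  sym_part mu S f (fun x => L * f x).
Proof.
move=> supL Sfg [f' adjf] max.
have [f2 g2] := (operator_dom_L2 linS Sfg, operator_val_L2 linS Sfg).
have [_ f'2 adj] := adjf.
split; first exact: L2_scale.
exists g, f'; split => //.
have Lf2 := L2_scale L f2.
have gf'2 := L2_add g2 f'2.
apply: (dense_separates dS) => //; first exact: L2_scale.
move=> h [h' Sh].
have [h2 h'2] := (operator_dom_L2 linS Sh, operator_val_L2 linS Sh).
rewrite !ip_scalel// ip_addl//; apply/eqP; rewrite -subr_eq0; apply/eqP.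
apply: (@quadratic_ge0_linear_eq0 _ _ (L * ip h h - ip h' h)) => t.
have := rayleigh_sup_bound supL (operator_lincomb linS t Sh Sfg).
rewrite !ip_lincombl ?L2_lincomb// !ip_lincombr// max (adj _ _ Sh).
rewrite (ipC _ f h) (ipC _ f' h) -subr_ge0; congr (_ <= _); lra.
Qed.

Lemma eigenvalue_eq_ae_scale (l c : R) f g : S f (fun x => l * f x) ->
  dom S g -> g = (fun x => c * f x) %[ae mu] -> S g (fun x => l * g x).
Proof.
move=> Sf [g' Sg] gf; have g2 := operator_dom_L2 linS Sg.
apply: (operator_ae_val linS Sg); first exact: L2_scale.
have := operator_functional Sg (operator_scale c linS Sf) gf.
by move: gf; apply: filterS2 => x /(_ I) -> /(_ I) -> _; rewrite mulrCA.
Qed.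

End with_operator.
End operators.

(** * Generators *)

Section generators.
Context (R : realType) (dT : measure_display) (T : measurableType dT).
Context (mu : {measure set T -> \bar R}).
Local Notation L2 := (Lfun mu 2%:E).
Local Notation N2 f := ('N[mu]_2%:E[EFin \o f%R]%E).

(** The error in the difference quotient of a linear combination is almost
    everywhere the linear combination of the errors, so its norm is squeezed to
    0 by Minkowski's inequality. *)
Lemma generator_linear (Q : R -> (T -> R) -> T -> R) :
  C0_semigroup mu Q -> linear_operator mu (generator mu Q).
Proof.
move=> [QL2 Qlin _ _ _].
pose err f g t x := t^-1 * (Q t f x - f x) - g x.
have err_L2 f g t : f \in L2 -> g \in L2 -> 0 <= t -> err f g t \in L2.
  move=> f2 g2 t0; apply: L2_sub => //; apply: L2_scale.
  by apply: L2_sub => //; exact: QL2.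
split.
- by move=> f g [].
- by move=> f g [].
- move=> c f f' g g' [f2 f'2 cf] [g2 g'2 cg]; split; try exact: L2_lincomb.
  have bound_cvg0 :
      (`|c|%:E * N2 (err f f' t) + N2 (err g g' t))%E @[t --> 0^'+] --> 0%E.
    rewrite -[X in _ --> X]adde0 -[X in _ --> (X + _)%E](mule0 `|c|%:E).
    by apply: cvgeD; [rewrite mule0|exact: cvgeZl|].
  apply: (squeeze_cvge _ (cvg_cst 0%E) bound_cvg0).
  near=> t; rewrite Lnorm_ge0 /=.
  have t0 : 0 <= t by near: t; exact: nbhs_right_ge.
  have ef2 : err f f' t \in L2 by exact: err_L2.
  have eg2 : err g g' t \in L2 by exact: err_L2.
  have fg2 := L2_lincomb c f2 g2.
  have fg'2 := L2_lincomb c f'2 g'2.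
  rewrite -Lnorm2_scale//.
  rewrite (@Lnorm2_ae_eq _ _ _ _ (err _ _ t)
    ((fun x => c * err f f' t x) \+ err g g' t)).
  + apply: eminkowski.
    * exact: L2_measurable (L2_scale c ef2).
    * exact: L2_measurable eg2.
    * by rewrite lee_fin ler1n.
  + exact: err_L2.
  + exact: L2_lincomb.
  + have := Qlin t c f g t0 f2 g2; apply: filterS => x /[apply] /= Qx.
    by rewrite /err Qx; ring.
- move=> f g g' [f2 g2 cfg] g'2 gg'; split=> //.
  apply: cvg_trans cfg; apply: near_eq_cvg; near=> t.
  have t0 : 0 <= t by near: t; exact: nbhs_right_ge.
  apply: (@Lnorm2_ae_eq _ _ _ _ (err f g t) (err f g' t));
    rewrite ?err_L2//.
  by move: gg'; apply: filterS => x /[apply] gx; rewrite /err gx.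
Unshelve. all: end_near. Qed.

End generators.

(** * Comparison of the two principal eigenvalues *)

Section variational.
Context (R : realType) (dT : measure_display) (T : measurableType dT).
Context (mu : {measure set T -> \bar R}).
Context (S : operator R T) (L l : R) (psi r : T -> R).
Context (linS : linear_operator mu S).
Context (dsym : densely_defined mu (sym_part mu S)).
Context (supL : rayleigh_sup mu S = L%:E).
Context (hpsi : eigenfunction mu (sym_part mu S) L psi).
Context (hr : eigenfunction mu S l r).

Lemma eigenvalue_le_rayleigh_sup : l <= L.
Proof.
have [Sr r0] := hr; have r2 := operator_dom_L2 linS Sr.
have := rayleigh_sup_bound linS supL Sr; rewrite ip_scalel//.
by rewrite ler_pM2r// ip_gt0.
Qed.

(** For L <= l the function psi, with zero imaginary part, is exhibited as an
    eigenfunction of the complexification of S. *)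
Lemma leading_eigenvalue_eqP : simple_eigenvalue mu (sym_part mu S) L ->
  leading_eigenvalue mu S l -> dom (adjoint mu S) r ->
  l = L <-> S psi (fun x => L * psi x).
Proof.
move=> [_ simple] [_ leading] adjr.
have [Sr r0] := hr; have [symS psi0] := hpsi.
split=> [lL|Spsi].
  rewrite lL in Sr; have r2 := operator_dom_L2 linS Sr.
  have symr : sym_part mu S r (fun x => L * r x).
    by apply: (rayleigh_maximizer linS dsym supL Sr adjr); rewrite ip_scalel.
  have [c psiE] := simple _ _ hpsi (conj symr r0).
  have [dpsi _] := sym_part_dom symS.
  exact: eigenvalue_eq_ae_scale Sr dpsi psiE.
apply/eqP; rewrite eq_le eigenvalue_le_rayleigh_sup /=.
apply: (leading L%:C%C); exists psi, (cst 0); split=> /=.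
- by under eq_fun do rewrite mul0r subr0.
- rewrite (_ : (fun x => _) = cst 0); first exact: (operator0 linS Spsi).
  by apply/funext => x; rewrite mulr0 mul0r addr0.
- by case.
Qed.

Lemma sym_part_eigenvalue_eq : S psi (fun x => l * psi x) -> l = L.
Proof.
move=> Spsi; have [symS psi0] := hpsi; have psi2 := operator_dom_L2 linS Spsi.
have := sym_part_form linS symS Spsi; rewrite !ip_scalel// => /mulIf -> //.
by rewrite gt_eqF// ip_gt0.
Qed.

End variational.

Theorem proposition3p6 (R : realType) (d m : nat) (hd : (0 < d)%N)
  (dO : measure_display) (Omega : measurableType dO) (P : probability Omega R)
  (b : 'cV[R]_d -> 'cV[R]_d) (sigma : 'M[R]_(d, m))
  (B : R -> Omega -> 'cV[R]_m)
  (X : 'cV[R]_d -> R -> Omega -> 'cV[R]_d)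
  (leb : {measure set 'cV[R]_d -> \bar R}) (mu : probability 'cV[R]_d R)
  (hX : diffusion P b sigma B X)
  (hleb : is_lebesgue leb)
  (hmu : ergodic P X leb mu)
  (a : observable R d) (ha : admissible leb a)
  (A : 'cV[R]_d -> R -> Omega -> R)
  (hA : forall x, is_functional P a (X x) (A x))
  (k : R) (hk : tilted P mu X A k)
  (Lambda lambda_max : R) (psi r : 'cV[R]_d -> R)
  (hLambda_sup : rayleigh_sup mu (tilted_generator P mu X A k) = Lambda%:E)
  (hLambda_max :
    largest_eigenvalue mu (sym_part mu (tilted_generator P mu X A k)) Lambda)
  (hLambda_simple :
    simple_eigenvalue mu (sym_part mu (tilted_generator P mu X A k)) Lambda)
  (hlambda_max :
    leading_eigenvalue mu (tilted_generator P mu X A k) lambda_max)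
  (psi_gt0 : {ae mu, forall x, 0 < psi x})
  (hpsi :
    eigenfunction mu (sym_part mu (tilted_generator P mu X A k)) Lambda psi)
  (r_gt0 : {ae mu, forall x, 0 < r x})
  (r_dom : dom (adjoint mu (tilted_generator P mu X A k)) r)
  (hr : eigenfunction mu (tilted_generator P mu X A k) lambda_max r) :
  [/\ lambda_max <= Lambda,
      lambda_max = Lambda <->
        antisym_part mu (tilted_generator P mu X A k) psi (cst 0) &
      lambda_max = Lambda <->
        eigenfunction mu (tilted_generator P mu X A k) lambda_max psi].
Proof.
have linS : linear_operator mu (tilted_generator P mu X A k).
  by apply: generator_linear; exact: fk_semigroup hk.
have [dsymc _] := sym_self_adjoint hk.
have dsym : densely_defined mu (sym_part mu (tilted_generator P mu X A k)).
  apply: densely_defined_closure dsymc => f [g /sym_part_dom[_]].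
  exact: dom_adjoint_L2.
have equality_case := leading_eigenvalue_eqP linS dsym hLambda_sup hpsi hr
  hLambda_simple hlambda_max r_dom.
split.
- exact: eigenvalue_le_rayleigh_sup linS hLambda_sup hr.
- have antisym_iff := sym_part_antisym_part0 linS dsym hpsi.1.
  exact: iff_trans equality_case (iff_sym antisym_iff).
- split=> [lL|[Spsi _]].
  + by split; [rewrite lL; exact: equality_case.1|exact: hpsi.2].
  + exact: sym_part_eigenvalue_eq linS hpsi Spsi.
Qed.
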